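(* Let $m$ be an odd positive integer and let $W=(w_{-r},\ldots,w_r)\in\mathbb{Z}^{2r+1}$ be the weight sequence of a one-dimensional additive cellular automaton such that $\sigma=-2\sigma'$ and $\sigma$ is invertible modulo $m$. Let $a,d\in\mathbb{Z}/m\mathbb{Z}$ with $d$ invertible. Then, in the orbit $\mathcal{O}(\mathrm{AP}(a,d))$, every $(0,1)$-antisymmetric triangle of orientation $(-1,1)$ or $(1,-1)$ and of size $s$ is balanced, for all positive integers $s\equiv 0$ or $-1\pmod{\mathrm{lcm}(\mathrm{pord}_m(\sigma),m)}$.
   Context: The ACA with weights $W$ maps a sequence $(a_i)_{i\in\mathbb{Z}}$ of $\mathbb{Z}/m\mathbb{Z}$ to $\left(\sum_{j=-r}^{r}w_ja_{i+j}\right)_{i\in\mathbb{Z}}$; $\sigma=\sum_jw_j$, $\sigma'=\sum_j jw_j$. $\mathrm{AP}(a,d)=(a+id)_{i\in\mathbb{Z}}$. The orbit is the array $(a_{i,j})_{(i,j)\in\mathbb{Z}\times\mathbb{N}}$ whose $j$-th row is $\partial^j(\mathrm{AP}(a,d))$. The triangle with principal vertex $j\in\mathbb{Z}\times\mathbb{N}$, orientation $\varepsilon\in\{-1,1\}^2$ and size $s$ is the multiset $\{a_{j+\varepsilon\cdot k}: k\in\mathbb{N}^2,\ k_1+k_2\le s-1\}$ ($\varepsilon\cdot k=(\varepsilon_1k_1,\varepsilon_2k_2)$, indices in $\mathbb{Z}\times\mathbb{N}$). It is $(0,1)$-antisymmetric if $a_{j+\varepsilon\cdot k}+a_{j+\varepsilon\cdot(s-1-k_1-k_2,\,k_2)}=0$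 for all $k\in\mathbb{N}^2$ with $k_1+k_2\le s-1$. Balanced means every element of $\mathbb{Z}/m\mathbb{Z}$ occurs with the same multiplicity. $\mathrm{pord}_m(\sigma)$ is the multiplicative order of $\sigma$ in $(\mathbb{Z}/m\mathbb{Z})^*/\{-1,1\}$, i.e. the least $k\ge1$ with $\sigma^k\equiv\pm1\pmod m$. *)

(* Defs.v *)
From mathcomp Require Import all_boot all_order all_algebra all_fingroup all_solvable.

Set Implicit Arguments.
Unset Strict Implicit.
Unset Printing Implicit Defensive.

Import GRing.Theory.
Local Open Scope ring_scope.

(* The additive group Z/mZ for m > 0. The library's 'Z_m is not used because
   it denotes Z/2Z when m = 1. For general m > 0 only the group structure is
   canonical; the product and unit are Zp_mul and Zp1. *)
Notation Zmod m := 'I_(m.-1.+1).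

Definition Zmod_invertible (m : nat) (x : Zmod m) : Prop :=
  exists y : Zmod m, Zp_mul x y = Zp1.

Definition invertible_mod (m : nat) (x : int) : Prop :=
  exists y : int, (x * y = 1 %[mod m])%Z.

Section ACA.
Variables (r : nat) (W : (r.*2.+1).-tuple int).

(* W = (w_{-r}, ..., w_r): position k of the tuple holds w_{k - r}. *)
Definition offset (k : 'I_(r.*2.+1)) : int := k%:Z - r%:Z.

Definition sigma : int := \sum_k tnth W k.

Definition sigma' : int := \sum_k offset k * tnth W k.

Definition aca (V : zmodType) (u : int -> V) : int -> V :=
  fun i => \sum_k u (i + offset k) *~ tnth W k.

Definition aca_orbit (V : zmodType) (u : int -> V) : int -> nat -> V :=
  fun i j => iter j (@aca V) u i.

End ACA.

Definition AP (V : zmodType) (a d : V) : int -> V := fun i => a + d *~ i.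

Section Triangles.
Variables (V : zmodType) (A : int -> nat -> V).
Variables (j : int * nat) (e : int * int) (s : nat).

(* All the positions j + e.k of the triangle have a nonnegative row index. *)
Definition triangle_in_array : Prop :=
  forall k : nat * nat, (k.1 + k.2 <= s.-1)%N -> 0 <= j.2%:Z + e.2 * k.2%:Z.

(* a_{j + e.k}; the absolute value only converts the row index to nat, it is
   meaningful under triangle_in_array. *)
Definition triangle_entry (k : nat * nat) : V :=
  A (j.1 + e.1 * k.1%:Z) (absz (j.2%:Z + e.2 * k.2%:Z)).

(* The multiset of the entries with k.1 + k.2 <= s - 1, as a sequence (only
   multiplicities matter). *)
Definition triangle : seq V :=
  [seq triangle_entry (k1, k2) | k2 <- iota 0 s, k1 <- iota 0 (s - k2)].

Definition antisymmetric01 : Prop :=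
  forall k : nat * nat, (k.1 + k.2 <= s.-1)%N ->
    triangle_entry k + triangle_entry ((s.-1 - k.1 - k.2)%N, k.2) = 0.

End Triangles.

Definition balanced (T : eqType) (M : seq T) : Prop :=
  forall x y : T, count_mem x M = count_mem y M.

Definition eq_pm1_mod (m : nat) (x : int) : bool :=
  (x == 1 %[mod m])%Z || (x == -1 %[mod m])%Z.

(* The least k >= 1 with x ^ k = 1 or -1 modulo m. Searching up to m suffices
   for x invertible modulo m, see pordP. *)
Definition pord (m : nat) (x : int) : nat :=
  (find (fun k => eq_pm1_mod m (x ^+ k)) (iota 1 m)).+1.

Lemma pordP (m : nat) (x : int) : (0 < m)%N -> invertible_mod m x ->
  eq_pm1_mod m (x ^+ pord m x) /\
  (forall k, (0 < k)%N -> eq_pm1_mod m (x ^+ k) -> (pord m x <= k)%N).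
Proof.
move=> m_gt0 [y xy1].
have cop : coprime `|(x %% m)%Z| m.
  have /coprimezP : exists uv, uv.1 * (x %% m)%Z + uv.2 * m%:Z = 1.
    exists (y, ((1 - (x %% m)%Z * y) %/ m)%Z) => /=.
    rewrite divzK ?[y * _]mulrC ?subrKC //.
    by rewrite -eqz_mod_dvd modzMml xy1.
  by rewrite coprimezE.
have tot_le : (totient m <= m)%N.
  rewrite totient_count_coprime big_mkord -[leqRHS]muln1.
  rewrite -[X in (_ <= X * 1)%N]card_ord -sum_nat_const.
  by apply: leq_sum => i _; apply: leq_b1.
have Etot : eq_pm1_mod m (x ^+ totient m).
  apply/orP; left; apply/eqP; rewrite -modzXm.
  have -> : (x %% m)%Z = `|(x %% m)%Z|%N :> int.
    by rewrite gez0_abs // modz_ge0 // eqz_nat -lt0n.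
  by rewrite -rmorphXn /= natrXE !modz_nat Euler_exp_totient.
set P := fun k => eq_pm1_mod m (x ^+ k).
have hasP : has P (iota 1 m).
  apply/hasP; exists (totient m) => //.
  by rewrite mem_iota totient_gt0 m_gt0 add1n ltnS.
split.
  have := nth_find 0 hasP; rewrite nth_iota ?add1n //.
  by rewrite -[ltnRHS](size_iota 1) -has_find.
move=> [//|k] _ Pk; rewrite /pord ltnS leqNgt; apply/negP => lt_k.
have := before_find 0 lt_k; rewrite nth_iota ?add1n ?Pk //.
by apply: leq_trans lt_k _; rewrite -[leqRHS](size_iota 1) find_size.
Qed.

(* Main.v *)
(**
A multiset of [Z/mZ] is balanced as soon as the sum of [z ^+ x] over its
elements [x] vanishes for all complex [z != 1] with [z ^+ m = 1]. Row [N] of the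
orbit is a progression of common difference [d * sigma ^+ N], and antisymmetry
centers at 0 the part of it that lies in the triangle. So a part of length [l]
contributes the quantum integer [(w ^ l - w ^ (- l)) / (w - w^-1)] at
[w = z ^ (g * sigma ^+ N)] for some [g] invertible modulo [m]. As the length and
[N] both vary by steps of one, these contributions are periodic, and their sum
over a period [L] vanishes when [m] divides [L] and [sigma ^+ L] is 1 or -1. A
triangle of size [L - 1] misses one row, of length 0 or [L], whose quantum
integer is 0.
*)
Require Import Defs.
From mathcomp Require Import all_boot all_algebra all_solvable all_field.
From mathcomp Require Import zify ring.

Set Implicit Arguments.
Unset Strict Implicit.
Unset Printing Implicit Defensive.

Import GRing.Theory Num.Theory.
Local Open Scope ring_scope.

Lemma totient_lt (n : nat) : (1 < n)%N -> (totient n < n)%N.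
Proof.
case: n => [|[|n]] // _; rewrite totient_count_coprime big_nat_recl //.
rewrite /coprime gcdn0 /= add0n ltnS big_mkord -[leqRHS]card_ord -sum1_card.
by apply: leq_sum => i _; apply: leq_b1.
Qed.

Lemma Euler_exp_totientz (n : nat) (x : int) : (0 < n)%N -> coprimez x n ->
  (x ^+ totient n = 1 %[mod n])%Z.
Proof.
move=> n_gt0 co_xn; rewrite -modzXm.
have xE : (x %% n)%Z = `|(x %% n)%Z|%N :> int.
  by rewrite gez0_abs // modz_ge0 // eqz_nat -lt0n.
have co_absx : coprime `|(x %% n)%Z| n.
  by move: co_xn; rewrite /coprimez -gcdz_modl.
by rewrite xE -rmorphXn /= natrXE !modz_nat Euler_exp_totient.
Qed.

Lemma dvdn_eqz_mod (n m : nat) (x y : int) :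
  (n %| m)%N -> (x = y %[mod m])%Z -> (x = y %[mod n])%Z.
Proof.
move=> nm /eqP; rewrite eqz_mod_dvd => m_dvd; apply/eqP; rewrite eqz_mod_dvd.
exact: dvdz_trans m_dvd.
Qed.

Lemma eq_pm1_modX (m n : nat) (x : int) :
  eq_pm1_mod m x -> eq_pm1_mod m (x ^+ n).
Proof.
case/orP=> /eqP x_mod; rewrite /eq_pm1_mod -modzXm x_mod modzXm.
  by rewrite expr1n eqxx.
by rewrite -signr_odd; case: (odd n); rewrite eqxx ?orbT.
Qed.

Lemma dvdn_eq_pm1_mod (n m : nat) (x : int) :
  (n %| m)%N -> eq_pm1_mod m x -> eq_pm1_mod n x.
Proof.
move=> nm; rewrite /eq_pm1_mod.
by case/orP=> /eqP/(dvdn_eqz_mod nm)/eqP ->; rewrite ?orbT.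
Qed.

Lemma invertible_mod_coprimez (m : nat) (x : int) :
  invertible_mod m x -> coprimez x m.
Proof.
case=> y /eqP; rewrite eqz_mod_dvd => /dvdzP[c xy_sub1].
by apply/coprimezP; exists (y, - c); rewrite /= mulNr -xy_sub1; ring.
Qed.

Lemma exists_pm1_exponent (m s : nat) (x : int) :
    (0 < m)%N -> invertible_mod m x ->
    (s%:Z = 0 %[mod lcmn (pord m x) m])%Z \/
    (s%:Z = -1 %[mod lcmn (pord m x) m])%Z ->
  exists L : nat, [/\ L = s \/ L = s.+1, (m %| L)%N & eq_pm1_mod m (x ^+ L)].
Proof.
move=> m_gt0 x_inv s_mod.
suff [L L_s lcm_dvd] : exists2 L,
    L = s \/ L = s.+1 & (lcmn (pord m x) m %| L)%N.
  exists L; split=> //; first exact: dvdn_trans (dvdn_lcmr _ _) lcm_dvd.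
  have /dvdnP[q ->] := dvdn_trans (dvdn_lcml _ _) lcm_dvd.
  by rewrite mulnC exprM eq_pm1_modX //; have [] := pordP m_gt0 x_inv.
case: s_mod => /eqP; rewrite eqz_mod_dvd.
  by rewrite subr0; exists s; [left|].
by rewrite opprK addrC -intS; exists s.+1; [right|].
Qed.

Lemma sum_periodic_shift (V : nmodType) (f : nat -> V) (L a : nat) :
    (forall k, f (k + L)%N = f k) ->
  \sum_(k < L) f (k + a)%N = \sum_(k < L) f k.
Proof.
move=> f_per; elim: a => [|a IHa]; first by under eq_bigr do rewrite addn0.
rewrite -{}IHa; case: L f_per => [|L] f_per; first by rewrite !big_ord0.
rewrite big_ord_recr big_ord_recl /= addrC; congr (_ + _).
  by rewrite -(f_per a) addnS -addSn addnC.
by apply: eq_bigr => k _; rewrite addnS.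
Qed.

Lemma sum_unity_root_eq0 (R : idomainType) (x : R) (n : nat) :
  x ^+ n = 1 -> x != 1 -> \sum_(k < n) x ^+ k = 0.
Proof.
move=> xn1; rewrite -subr_eq0 => x_neq1; apply: (mulfI x_neq1).
by rewrite -subrX1 xn1 subrr mulr0.
Qed.

Section PrimitiveRootExponents.
Variables (F : fieldType) (n : nat) (z : F).
Hypothesis z_prim : n.-primitive_root z.

Lemma prim_root_neq0 : z != 0.
Proof.
apply: contra_eq_neq (prim_expr_order z_prim) => ->.
by rewrite expr0n gtn_eqF ?(prim_order_gt0 z_prim) // eq_sym oner_neq0.
Qed.

Lemma exprz_prim_root_eq1 (x : int) : (z ^ x == 1) = (n %| x)%Z.
Proof.
case: x => k; rewrite dvdzE /= ?NegzE -?exprnN -?exprnP ?invr_eq1;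
by rewrite (prim_order_dvd z_prim).
Qed.

Lemma eq_prim_root_exprz (x y : int) :
  (z ^ x == z ^ y) = (x == y %[mod n])%Z.
Proof.
have zy_neq0 : z ^ y != 0 by rewrite expfz_neq0 ?prim_root_neq0.
rewrite eqz_mod_dvd -exprz_prim_root_eq1 expfzDr ?prim_root_neq0 // -invr_expz.
by rewrite -[in RHS](divff zy_neq0) (inj_eq (mulIf _)) ?invr_eq0.
Qed.

Lemma prim_order_gt1 : z != 1 -> (1 < n)%N.
Proof.
rewrite ltn_neqAle (prim_order_gt0 z_prim) // andbT; apply: contra => /eqP n1.
by rewrite -[z]expr1 [X in _ ^+ X]n1 (prim_expr_order z_prim).
Qed.

Lemma exprz_prim_root_dvd (L : nat) (x e : int) :
  (n %| L)%N -> (z ^ x) ^ (e * L%:Z) = 1.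
Proof.
by move=> nL; apply/eqP; rewrite exprz_exp exprz_prim_root_eq1 !dvdz_mull.
Qed.

Lemma prim_root_exprz_neqV (x : int) :
  (1 < n)%N -> odd n -> coprimez x n -> z ^ x != (z ^ x)^-1.
Proof.
move=> n_gt1 n_odd co_xn.
rewrite invr_expz eq_prim_root_exprz eqz_mod_dvd opprK.
have -> : x + x = x * 2 by ring.
rewrite Gauss_dvdzr 1?coprimez_sym // dvdzE /=; apply: contraL n_odd => n_dvd2.
by rewrite (eqP (_ : n == 2)) // eqn_leq dvdn_leq.
Qed.

End PrimitiveRootExponents.

Lemma sum_prim_root_orthogonal (F : fieldType) (m : nat) (w : F) (x y : 'I_m) :
    m.-primitive_root w ->
  \sum_(k < m) (w ^+ y / w ^+ x) ^+ k = (y == x)%:R *+ m.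
Proof.
move=> w_prim; have w_neq0 := prim_root_neq0 w_prim.
have [->|y_neq_x] := eqVneq y x.
  rewrite divff ?expf_neq0 //; under eq_bigr do rewrite expr1n.
  by rewrite sumr_const card_ord.
rewrite mul0rn sum_unity_root_eq0 // ?expr_div_n.
  by rewrite !(exprAC _ _ m) (prim_expr_order w_prim) !expr1n divr1.
apply: contra y_neq_x => /eqP/divr1_eq/eqP.
by rewrite (eq_prim_root_expr w_prim) !modn_small.
Qed.

Lemma balanced_unity_root_sums (F : numFieldType) (m : nat) (w : F)
    (M : seq 'I_m) :
    m.-primitive_root w ->
    (forall z : F, z ^+ m = 1 -> z != 1 -> \sum_(x <- M) z ^+ x = 0) ->
  balanced M.
Proof.
move=> w_prim sums0; have m_gt0 := prim_order_gt0 w_prim.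
suff countE x : m%:R * (count_mem x M)%:R = (size M)%:R :> F.
  move=> x y; apply/eqP; rewrite -(eqr_nat F); apply/eqP.
  by apply: (mulfI (prim_root_natf_neq0 w_prim)); rewrite !countE.
transitivity (\sum_(y <- M) \sum_(k < m) (w ^+ y / w ^+ x) ^+ k).
  rewrite -sum1_count big_mkcond natr_sum mulr_sumr; apply: eq_bigr => y _.
  by rewrite sum_prim_root_orthogonal // mulr_natl /=; case: eqP.
pose k0 := Ordinal m_gt0.
have sum_k k : k != k0 -> \sum_(y <- M) (w ^+ y / w ^+ x) ^+ k = 0.
  move=> k_neq0; under eq_bigr do rewrite expr_div_n (exprAC _ _ k).
  rewrite -mulr_suml sums0 ?mul0r //.
    by rewrite exprAC (prim_expr_order w_prim) expr1n.
  by apply: contra k_neq0; rewrite -(prim_order_dvd w_prim) /dvdn modn_small.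
rewrite exchange_big (bigD1 k0) //= (big1 _ _ _ sum_k) addr0.
under eq_bigr do rewrite expr0.
by rewrite big_const_seq count_predT iter_addr_0.
Qed.

(* 0 when [w = w^-1], where the limit value would be [+-l]. *)
Definition quantum_int (F : fieldType) (w : F) (l : int) : F :=
  (w ^ l - w ^ (- l)) / (w - w^-1).

Section QuantumInt.
Variables (F : fieldType) (w : F).

Lemma quantum_int0 : quantum_int w 0 = 0.
Proof. by rewrite /quantum_int oppr0 subrr mul0r. Qed.

Lemma quantum_intV (l : int) : quantum_int w^-1 l = quantum_int w l.
Proof.
rewrite /quantum_int !exprz_inv opprK invrK.
by rewrite -opprB -[w^-1 - w]opprB invrN mulrNN.
Qed.

Lemma quantum_int_sum (l : nat) : w != w^-1 ->
  quantum_int w l = \sum_(k < l) w ^ (2 * k%:Z - (l%:Z - 1)).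
Proof.
move=> w_neqV; have w_neq0 : w != 0.
  by apply: contraNneq w_neqV => ->; rewrite invr0.
rewrite -subr_eq0 in w_neqV; apply: (mulIf w_neqV); rewrite divfK //.
pose f k := w ^ (2 * k%:Z - l%:Z).
transitivity (f l - f 0%N); first by rewrite /f; congr (_ ^ _ - _ ^ _); ring.
rewrite -telescope_sumr // big_mkord mulr_suml; apply: eq_bigr => k _.
rewrite /f mulrBr -[X in _ = _ * X - _]expr1z -exprN1 -!expfzDr //.
by congr (_ ^ _ - _ ^ _); ring.
Qed.

Hypothesis w_neq0 : w != 0.

Lemma quantum_intD_period (l p : int) :
  w ^ p = 1 -> quantum_int w (l + p) = quantum_int w l.
Proof.
by move=> wp1; rewrite /quantum_int -!invr_expz !expfzDr // wp1 mulr1.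
Qed.

Lemma sum_quantum_int_progression (L : nat) (c q : int) :
    w ^ (q * L%:Z) = 1 -> w ^ q != 1 ->
  \sum_(t < L) quantum_int w (c + q * t%:Z) = 0.
Proof.
move=> wqL1 wq_neq1.
have geometric (v : F) : v != 0 -> v ^ (q * L%:Z) = 1 -> v ^ q != 1 ->
    \sum_(t < L) v ^ (c + q * t%:Z) = 0.
  move=> v_neq0 vqL1 vq_neq1.
  under eq_bigr do rewrite expfzDr // -exprz_exp -exprnP.
  by rewrite -mulr_sumr sum_unity_root_eq0 ?mulr0 // exprnP exprz_exp.
rewrite -mulr_suml sumrB geometric //.
under eq_bigr do rewrite -exprz_inv.
by rewrite geometric ?subrr ?mul0r ?invr_eq0 // -expfV ?wqL1 ?invr1 ?invr_eq1.
Qed.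

End QuantumInt.

Section QuantumIntSum.
Variables (F : numFieldType) (n L : nat) (z : F) (u : int).
Hypotheses (z_prim : n.-primitive_root z) (n_gt1 : (1 < n)%N).
Hypotheses (n_dvd_L : (n %| L)%N) (u_coprime : coprimez u n).
Hypothesis uL_pm1 : eq_pm1_mod n (u ^+ L).

Lemma quantum_int_exp_period (g l e : int) (k : nat) :
  quantum_int (z ^ (g * u ^+ (k + L))) (l + e * L%:Z) =
  quantum_int (z ^ (g * u ^+ k)) l.
Proof.
have z_neq0 := prim_root_neq0 z_prim.
rewrite quantum_intD_period ?expfz_neq0 ?(exprz_prim_root_dvd z_prim) //.
have eq_exp_mod x y : (x = y %[mod n])%Z ->
    z ^ (g * u ^+ k * x) = z ^ (g * u ^+ k * y).
  move=> xy; apply/eqP.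
  by rewrite (eq_prim_root_exprz z_prim) -modzMmr xy modzMmr.
rewrite exprD mulrA; case/orP: uL_pm1 => /eqP/eq_exp_mod ->.
  by rewrite mulr1.
by rewrite mulrN1 -invr_expz quantum_intV.
Qed.

(* Summing over all shifts by multiples of [totient n], along which
   [z ^ (g * u ^+ k)] is constant, turns the sum into geometric ones. *)
Lemma sum_quantum_int_exp_eq0 (g c e : int) : coprimez g n -> coprimez e n ->
  \sum_(k < L) quantum_int (z ^ (g * u ^+ k)) (c + e * k%:Z) = 0.
Proof.
move=> g_coprime e_coprime.
have [->|L_gt0] := posnP L; first by rewrite big_ord0.
have n_gt0 := ltnW n_gt1.
pose f k := quantum_int (z ^ (g * u ^+ k)) (c + e * k%:Z).
have f_period k : f (k + L)%N = f k.
  by rewrite /f PoszD mulrDr addrA quantum_int_exp_period.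
have sum_shifts k : \sum_(t < L) f (k + totient n * t)%N = 0.
  rewrite -[RHS](@sum_quantum_int_progression _ (z ^ (g * u ^+ k)) _ L
    (c + e * k%:Z) (e * (totient n)%:Z)).
  - apply: eq_bigr => t _; rewrite /f PoszD PoszM.
    congr quantum_int; last by ring.
    apply/eqP; rewrite (eq_prim_root_exprz z_prim) exprD mulrA -modzMmr exprM.
    by rewrite -modzXm Euler_exp_totientz // modzXm expr1n modzMmr mulr1.
  - by rewrite expfz_neq0 // (prim_root_neq0 z_prim).
  - exact: (exprz_prim_root_dvd z_prim).
  - rewrite exprz_exp (exprz_prim_root_eq1 z_prim).
    rewrite mulrA Gauss_dvdzr.
      by rewrite dvdzE gtnNdvd ?totient_gt0 ?totient_lt.
    by rewrite coprimez_sym !coprimezMl g_coprime e_coprime coprimezXl.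
have : L%:R * \sum_(k < L) f k = 0.
  rewrite mulr_natl -[X in _ *+ X]card_ord -sumr_const.
  under eq_bigr => t _ do
    rewrite -(sum_periodic_shift (totient n * t) f_period).
  by rewrite exchange_big big1.
by move/eqP; rewrite mulf_eq0 pnatr_eq0 gtn_eqF // => /eqP.
Qed.

Variables (s : nat) (g : int).
Hypotheses (L_s : L = s \/ L = s.+1) (g_coprime : coprimez g n).

Lemma sum_quantum_int_expD (N : nat) :
  \sum_(k < s) quantum_int (z ^ (g * u ^+ (N + k))) (s - k)%N = 0.
Proof.
transitivity
    (\sum_(k < L) quantum_int (z ^ (g * u ^+ N * u ^+ k)) (s%:Z + -1 * k%:Z)).
  under eq_bigr => k _ do rewrite exprD mulrA -subzn 1?ltnW // -mulN1r.
  case: L_s => -> //; rewrite big_ord_recr /=.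
  by rewrite mulN1r subrr quantum_int0 addr0.
rewrite sum_quantum_int_exp_eq0 //.
  by rewrite coprimezMl g_coprime coprimezXl.
by rewrite coprimeNz coprimezE coprime1n.
Qed.

Lemma sum_quantum_int_expB (N : nat) : (s <= N.+1)%N ->
  \sum_(k < s) quantum_int (z ^ (g * u ^+ (N - k))) (s - k)%N = 0.
Proof.
move=> s_le; rewrite (reindex_inj rev_ord_inj) /=.
pose gN := g * u ^+ (N.+1 - s).
transitivity (\sum_(k < L) quantum_int (z ^ (gN * u ^+ k)) (1 + 1 * k%:Z)).
  have lengthE (k : nat) : 1 + 1 * k%:Z = k.+1%:Z by rewrite mul1r -intS.
  under [RHS]eq_bigr do rewrite lengthE.
  transitivity (\sum_(k < s) quantum_int (z ^ (gN * u ^+ k)) k.+1).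
    apply: eq_bigr => k _; rewrite subKn // /gN -mulrA -exprD.
    by congr (quantum_int (z ^ (g * u ^+ _)) _); have := ltn_ord k; lia.
  case: L_s => Ls; rewrite Ls // big_ord_recr /=.
  rewrite -[s.+1%:Z]mul1r -[1 * s.+1%:Z]add0r quantum_intD_period.
  - by rewrite quantum_int0 addr0.
  - by rewrite expfz_neq0 ?(prim_root_neq0 z_prim).
  - by apply: (exprz_prim_root_dvd z_prim); rewrite -Ls.
rewrite sum_quantum_int_exp_eq0 //; last by rewrite coprimezE coprime1n.
by rewrite coprimezMl g_coprime coprimezXl.
Qed.

End QuantumIntSum.

Lemma aca_AP (r : nat) (W : (r.*2.+1).-tuple int) (V : zmodType) (a d : V) :
  aca W (AP a d) =1 AP (a *~ sigma W + d *~ sigma' W) (d *~ sigma W).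
Proof.
move=> i; rewrite /aca /AP /sigma /sigma' !mulrz_sumr mulrz_suml -!big_split.
apply: eq_bigr => k _ /=; rewrite mulrzDl mulrzDr mulrzDl -!mulrzA -addrA.
by rewrite [in RHS](mulrC _ i) [d *~ (i * _) + _]addrC.
Qed.

Lemma eq_aca (r : nat) (W : (r.*2.+1).-tuple int) (V : zmodType)
    (f g : int -> V) :
  f =1 g -> aca W f =1 aca W g.
Proof. by move=> fg i; apply: eq_bigr => k _; rewrite fg. Qed.

Lemma aca_orbit_AP (r : nat) (W : (r.*2.+1).-tuple int) (V : zmodType) (a d : V)
    (n : nat) :
  exists b, forall i, aca_orbit W (AP a d) i n = AP b (d *~ (sigma W ^+ n)) i.
Proof.
elim: n => [|n [b IHn]]; first by exists a.
exists (b *~ sigma W + d *~ (sigma W ^+ n) *~ sigma' W) => i.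
by rewrite /aca_orbit iterS (eq_aca W IHn) aca_AP exprSr mulrzA.
Qed.

Lemma antisymmetric01_entry_double (r : nat) (W : (r.*2.+1).-tuple int)
    (V : zmodType) (a d : V) (j : int * nat) (e : int * int) (s k1 k2 : nat) :
    antisymmetric01 (aca_orbit W (AP a d)) j e s -> (k1 + k2 < s)%N ->
  triangle_entry (aca_orbit W (AP a d)) j e (k1, k2) *~ 2 =
  d *~ (e.1 * sigma W ^+ absz (j.2%:Z + e.2 * k2%:Z)
        * (2 * k1%:Z - ((s - k2)%N%:Z - 1))).
Proof.
move=> antisym k_lt; have s_gt0 : (0 < s)%N by apply: leq_ltn_trans k_lt.
have k_le : (k1 + k2 <= s.-1)%N by rewrite -ltnS prednK.
have := antisym (k1, k2) k_le; rewrite /triangle_entry /=.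
have [b rowE] := aca_orbit_AP W a d (absz (j.2%:Z + e.2 * k2%:Z)).
rewrite !rowE /AP => /eqP; rewrite addr_eq0 => /eqP entry_opp.
rewrite -[_ *~ 2]/(_ *+ 2) mulr2n {2}entry_opp opprD addrACA subrr add0r.
have -> : (s.-1 - k1 - k2)%N%:Z = (s - k2)%N%:Z - 1 - k1%:Z by lia.
by rewrite -!mulrzA -mulrzBr; congr (_ *~ _); ring.
Qed.

Lemma triangle_in_array_size_le (j : int * nat) (e1 : int) (s : nat) :
  triangle_in_array j (e1, -1) s -> (s <= j.2.+1)%N.
Proof. by move=> /(_ (0%N, s.-1) (leqnn _)) /=; lia. Qed.

Lemma modz_Zmod_mulrz (m : nat) (x : Zmod m) (c : int) :
  (0 < m)%N -> ((x *~ c : Zmod m)%:Z = x%:Z * c %[mod m])%Z.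
Proof.
case: m x => // m x _.
have mulrnE n : ((x *+ n : Zmod m.+1)%:Z = x%:Z * n %[mod m.+1])%Z.
  by rewrite Zp_mulrn -PoszM !modz_nat /= modn_mod.
case: c => n; first by rewrite -pmulrn mulrnE.
rewrite NegzE mulrNz -pmulrn mulrN -[RHS]modzNm -mulrnE modzNm.
set y := x *+ n.+1.
rewrite modz_nat /= modn_mod -modz_nat -subzn; last exact: ltnW.
by rewrite modzDl.
Qed.

Lemma Zmod_invertible_coprimez (m : nat) (d : Zmod m) :
  (0 < m)%N -> Zmod_invertible d -> coprimez d m.
Proof.
move=> m_gt0 [y /(congr1 val) /= dy].
apply: invertible_mod_coprimez; exists y%:Z.
rewrite -PoszM !modz_nat; move: (d : nat) (y : nat) dy => d_val y_val.
by rewrite prednK // => ->.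
Qed.

Section AntisymmetricTriangleSum.
Variables (r : nat) (W : (r.*2.+1).-tuple int) (m : nat) (a d : Zmod m).
Variables (j : int * nat) (e : int * int) (s : nat).
Hypotheses (m_odd : odd m) (d_inv : Zmod_invertible d).
Hypotheses (e_coprime : coprimez e.1 m) (sigma_coprime : coprimez (sigma W) m).
Hypothesis antisym : antisymmetric01 (aca_orbit W (AP a d)) j e s.
Variables (F : fieldType) (n : nat) (z : F).
Hypotheses (z_prim : n.-primitive_root z) (n_gt1 : (1 < n)%N).
Hypothesis n_dvd_m : (n %| m)%N.

Lemma expr_antisymmetric01_entry (h : int) (k1 k2 : nat) :
    (2 * h = 1 %[mod n])%Z -> (k1 + k2 < s)%N ->
  z ^+ triangle_entry (aca_orbit W (AP a d)) j e (k1, k2) =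
  (z ^ (h * d%:Z * e.1 * sigma W ^+ absz (j.2%:Z + e.2 * k2%:Z)))
    ^ (2 * k1%:Z - ((s - k2)%N%:Z - 1)).
Proof.
move=> h2 k_lt; set x := triangle_entry _ _ _ _.
have m_gt0 := odd_gt0 m_odd.
have entry_double := antisymmetric01_entry_double antisym k_lt.
apply/eqP; rewrite exprnP exprz_exp (eq_prim_root_exprz z_prim); apply/eqP.
rewrite -[x%:Z]mul1r -modzMml -h2 modzMml -mulrA mulrCA.
have := modz_Zmod_mulrz x 2 m_gt0; rewrite entry_double modz_Zmod_mulrz //.
move=> /(dvdn_eqz_mod n_dvd_m) double_mod.
by rewrite [2 * x%:Z]mulrC -[LHS]modzMmr -double_mod modzMmr -!mulrA.
Qed.

Lemma sum_expr_antisymmetric01_triangle :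
  exists2 g : int, coprimez g n &
    \sum_(x <- triangle (aca_orbit W (AP a d)) j e s) z ^+ x =
    \sum_(k < s) quantum_int
      (z ^ (g * sigma W ^+ absz (j.2%:Z + e.2 * k%:Z))) (s - k)%N.
Proof.
have n_odd := dvdn_odd n_dvd_m m_odd.
pose h : int := (n.+1)./2%:Z.
have h2 : (2 * h = 1 %[mod n])%Z.
  have -> : 2 * h = n%:Z + 1 by rewrite /h; lia.
  by rewrite modzDl.
pose g := h * d%:Z * e.1; have g_coprime : coprimez g n.
  have h_coprime : coprimez h n.
    by apply: invertible_mod_coprimez; exists 2; rewrite mulrC.
  rewrite !coprimezMl h_coprime /=.
  rewrite (coprimez_dvdr n_dvd_m e_coprime) andbT (coprimez_dvdr n_dvd_m) //.
  exact: Zmod_invertible_coprimez (odd_gt0 m_odd) d_inv.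
exists g => //.
have iotaE N : iota 0 N = index_iota 0 N by rewrite /index_iota subn0.
rewrite big_allpairs_dep iotaE big_mkord; apply: eq_bigr => k2 _.
rewrite quantum_int_sum; last first.
  apply: (prim_root_exprz_neqV z_prim) => //.
  by rewrite coprimezMl g_coprime coprimezXl // (coprimez_dvdr n_dvd_m).
rewrite iotaE big_mkord; apply: eq_bigr => k1 _.
by rewrite (expr_antisymmetric01_entry h2) // addnC -ltn_subRL.
Qed.

End AntisymmetricTriangleSum.

Theorem theorem5p6 (m : nat) (m_odd : odd m)
    (r : nat) (W : (r.*2.+1).-tuple int)
    (sigmaE : sigma W = - 2 * sigma' W)
    (sigma_inv : invertible_mod m (sigma W))
    (a d : Zmod m) (d_inv : Zmod_invertible d)
    (j : int * nat) (e : int * int) (s : nat)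
    (e_orient : e = (-1, 1) \/ e = (1, -1))
    (s_gt0 : (0 < s)%N)
    (s_mod : (s%:Z = 0 %[mod lcmn (pord m (sigma W)) m])%Z \/
             (s%:Z = -1 %[mod lcmn (pord m (sigma W)) m])%Z)
    (fits : triangle_in_array j e s)
    (antisym : antisymmetric01 (aca_orbit W (AP a d)) j e s) :
  balanced (triangle (aca_orbit W (AP a d)) j e s).
Proof.
have m_gt0 := odd_gt0 m_odd.
have [L [L_s m_dvd_L sigmaL]] := exists_pm1_exponent m_gt0 sigma_inv s_mod.
have sigma_coprime := invertible_mod_coprimez sigma_inv.
have e_coprime : coprimez e.1 m.
  by case: e_orient => ->; rewrite ?coprimeNz coprimezE coprime1n.
have [w w_prim] := C_prim_root_exists (ltn0Sn m.-1).
apply: (balanced_unity_root_sums w_prim) => z zm1 z_neq1.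
rewrite prednK // in zm1.
have [n z_prim n_dvd_m] := prim_order_exists m_gt0 zm1.
have n_gt1 := prim_order_gt1 z_prim z_neq1.
have [g g_coprime ->] := sum_expr_antisymmetric01_triangle m_odd d_inv e_coprime
  sigma_coprime antisym z_prim n_gt1 n_dvd_m.
have n_dvd_L := dvdn_trans n_dvd_m m_dvd_L.
have sigmaL_n := dvdn_eq_pm1_mod n_dvd_m sigmaL.
have sigma_n := coprimez_dvdr n_dvd_m sigma_coprime.
case: e_orient fits => -> fits /=.
  under eq_bigr do rewrite mul1n.
  by rewrite (sum_quantum_int_expD z_prim n_gt1 n_dvd_L sigma_n sigmaL_n L_s).
have s_le := triangle_in_array_size_le fits.
under eq_bigr => k _ do
  (rewrite mulN1r subzn ?absz_nat;
   last by rewrite -ltnS (leq_trans (ltn_ord k))).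
by rewrite (sum_quantum_int_expB z_prim n_gt1 n_dvd_L sigma_n sigmaL_n L_s).
Qed.
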